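(* Let $R \in \mathbb{R}^{m \times m}$ be the data error covariance matrix and assume that $R$ is positive definite. Then for every $1 \le k \le N$ the linear system $W^{(k)} Z^{(k)} = D$, where $W^{(k)} = R + \sum_{i=1}^{k} v_i v_i^T$, has a unique solution $Z^{(k)} \in \mathbb{R}^{m \times N}$.
   Context: Setting: the analysis step of the ensemble Kalman filter, with $n$ the model state dimension, $m$ the number of observations and $N \ge 2$ the number of ensemble members. The background ensemble is $X^B = (x_1, \ldots, x_N) \in \mathbb{R}^{n \times N}$, with mean $\bar{x} = \frac{1}{N}\sum_{i=1}^N x_i$. The matrix of member deviations is $S = \frac{1}{\sqrt{N-1}}(x_1 - \bar{x}, \ldots, x_N - \bar{x}) \in \mathbb{R}^{n \times N}$. The observation operator is a matrix $H \in \mathbb{R}^{m \times n}$. Put $V = H S \in \mathbb{R}^{m \times N}$ and let $v_1, \ldots, v_N \in \mathbb{R}^m$ be the columns of $V$. The matrix $R \in \mathbb{R}^{m\times m}$ is the covariance matrix of the data errors (in particular symmetric). The right-hand side is $D = Y - H X^B \in \mathbb{R}^{m \times N}$, where $Y \in \mathbb{R}^{m \times N}$ is the matrix of perturbed observations. The sequence $W^{(0)}, \ldots, W^{(N)}$ is defined by $W^{(0)} = R$ and $W^{(k)} = W^{(k-1)} + v_k v_k^T$ for $1 \le k \le N$. *)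

(* Defs.v *)
From HB Require Import structures.
From mathcomp Require Import all_boot all_order all_algebra.
From mathcomp Require Import reals.

Set Implicit Arguments.
Unset Strict Implicit.
Unset Printing Implicit Defensive.

Import Order.TTheory GRing.Theory Num.Theory.
Local Open Scope ring_scope.

(* Symmetry is not included; it is [A \is symmetricmx]. *)
Definition posdefmx (K : realType) (m : nat) (A : 'M[K]_m) : Prop :=
  forall x : 'cV[K]_m, x != 0 -> 0 < (x^T *m A *m x) 0 0.

(* The ensemble members are the columns of X. *)
Definition ens_mean (K : realType) (n N : nat) (X : 'M[K]_(n, N)) : 'cV[K]_n :=
  N%:R^-1 *: \sum_(i < N) col i X.

Definition ens_dev (K : realType) (n N : nat) (X : 'M[K]_(n, N)) :
    'M[K]_(n, N) :=
  (Num.sqrt (N.-1)%:R)^-1 *: \matrix_(i, j) (X i j - ens_mean X i 0).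

(* R plus the first k of the rank-one terms v v^T, v a column of V.  Columns are
   numbered from 0, so the mathematical v_1, ..., v_k are the columns i < k. *)
Definition Wseq (K : realType) (m N : nat) (R : 'M[K]_m) (V : 'M[K]_(m, N))
    (k : nat) : 'M[K]_m :=
  R + \sum_(i < N | (i < k)%N) col i V *m (col i V)^T.

Lemma Wseq0 (K : realType) (m N : nat) (R : 'M[K]_m) (V : 'M[K]_(m, N)) :
  Wseq R V 0 = R.
Proof. by rewrite /Wseq big_pred0 ?addr0. Qed.

Lemma WseqS (K : realType) (m N : nat) (R : 'M[K]_m) (V : 'M[K]_(m, N))
    (k : 'I_N) :
  Wseq R V k.+1 = Wseq R V k + col k V *m (col k V)^T.
Proof.
rewrite /Wseq (bigD1 k) ?ltnS //= -addrA; congr (_ + _); rewrite addrC.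
congr (_ + _); apply: eq_bigl => i.
by rewrite ltnS ltn_neqAle andbC.
Qed.

(* Main.v *)
Require Import Defs.
From HB Require Import structures.
From mathcomp Require Import all_boot all_order all_algebra.
From mathcomp Require Import reals.

Set Implicit Arguments.
Unset Strict Implicit.
Unset Printing Implicit Defensive.

Import Order.TTheory GRing.Theory Num.Theory.
Local Open Scope ring_scope.

(** Each [v *m v^T] is positive semidefinite, so adding such terms to a positive definite [R] keeps
    it positive definite ([posdefmx_Wseq]). A positive definite matrix has trivial kernel, hence is
    invertible ([posdefmx_unit]), and the only solution is the inverse applied to [D]. *)

Lemma posdefmx_unit (K : realType) (m : nat) (A : 'M[K]_m) :
  posdefmx A -> A \in unitmx.
Proof.
(* [det0P] yields a nonzero row vector with [v *m A = 0]; its transpose is a column on which the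
   form vanishes. *)
move=> Apos; rewrite unitmxE unitfE; apply/negP => /det0P[v v0 vA0].
have /Apos : v^T != 0 by rewrite trmx_eq0.
by rewrite trmxK vA0 mul0mx mxE ltxx.
Qed.

(** The form is the square of the scalar [v^T *m x]. *)
Lemma rank1_form_ge0 (K : realType) (m : nat) (v x : 'cV[K]_m) :
  0 <= (x^T *m (v *m v^T) *m x) 0 0.
Proof.
rewrite mulmxA -mulmxA -[x^T *m v]trmxK trmx_mul trmxK.
by rewrite mxE big_ord1 [(_^T) _ _]mxE -expr2 sqr_ge0.
Qed.

Lemma posdefmx_Wseq (K : realType) (m N : nat) (R : 'M[K]_m)
    (V : 'M[K]_(m, N)) (k : nat) :
  posdefmx R -> posdefmx (Wseq R V k).
Proof.
(* Strictness comes from [R] alone; the whole sum need only be nonnegative, so no induction on [k]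
   is required. *)
move=> Rpos x x0; rewrite /Wseq mulmxDr mulmxDl mxE ltr_pwDl ?Rpos//.
rewrite mulmx_sumr mulmx_suml summxE sumr_ge0// => i _.
exact: rank1_form_ge0.
Qed.

Theorem theorem3 (K : realType) (n m N : nat) (hN : (2 <= N)%N)
    (X : 'M[K]_(n, N)) (H : 'M[K]_(m, n)) (Y : 'M[K]_(m, N)) (R : 'M[K]_m)
    (hRsym : R \is symmetricmx) (hRpos : posdefmx R)
    (k : nat) (hk : (1 <= k <= N)%N) :
  let V := H *m ens_dev X in
  let D := Y - H *m X in
  exists! Z : 'M[K]_(m, N), Wseq R V k *m Z = D.
Proof.
move=> V D; have Wunit := posdefmx_unit (posdefmx_Wseq V k hRpos).
exists (invmx (Wseq R V k) *m D); split; first by rewrite mulKVmx.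
by move=> Z <-; rewrite mulKmx.
Qed.
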